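(* Let $X$ be an infinite topological space such that for every $N \in \mathbb{N}$ the space $X^N$, with the product topology, is a Baire space. Let $f_0, f_1, \ldots, f_n : X \to \mathbb{R}$ be linearly independent real-valued functions on $X$. Put $\mathcal{F} = \mathrm{span}\langle f_0, f_1, \ldots, f_n\rangle$ and $$\mathcal{C} = \{\, \{x \in X : f_0(x) - f(x) > 0\} \;:\; f \in \mathrm{span}\langle f_1, \ldots, f_n\rangle \,\}.$$ If $\mathcal{F}$ is admissible, then for every natural number $N > n$ there is a subset $X_0 \subseteq X$ with $|X_0| = N$ such that $\mathcal{C}\vert_{X_0}$ is maximum of VC dimension $n$ (as a set system on $X_0$).
   Context: Spans are over $\mathbb{R}$. Set systems. A set system on a set $Y$ is any $\mathcal{C} \subseteq \mathcal{P}(Y)$. For $Y_0 \subseteq Y$, $\mathcal{C}\vert_{Y_0} = \{C \cap Y_0 : C \in \mathcal{C}\}$. $\mathcal{C}$ shatters $Y_0$ if $\mathcal{C}\vert_{Y_0} = \mathcal{P}(Y_0)$. For non-empty $\mathcal{C}$, the VC dimension of $\mathcal{C}$ is $\sup\{|Y_0| : Y_0 \subseteq Y \text{ is shattered by } \mathcal{C}\}$. For natural numbers $m, d$ define $\binom{m}{\leq d} = \sum_{i=0}^{d} \binom{m}{i}$ if $m \geq d$, and $\binom{m}{\leq d} = 2^m$ if $m < d$. A set system $\mathcal{C}$ on $Y$ of VC dimension $\alpha$ (finite) is called maximum of VC dimension $\alpha$ if for every finite $Y_0 \subseteq Y$, $|\mathcal{C}\vert_{Y_0}| = \binom{|Y_0|}{\leq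 \alpha}$. Admissible. A finite-dimensional real vector space $\mathcal{F}$ of real-valued functions on a topological space $X$ is admissible if for every $f \in \mathcal{F}$: (1) $f$ is continuous; and (2) if $f^{-1}(0)$ has non-empty interior, then $f$ is constantly zero. Baire space. A non-empty topological space is a Baire space if any countable union of closed sets with empty interior has empty interior. *)

(* Defs.v *)
From mathcomp Require Import all_boot all_order all_algebra.
From mathcomp Require Import all_classical all_reals all_analysis.

Set Implicit Arguments.
Unset Strict Implicit.
Unset Printing Implicit Defensive.

Import Order.TTheory GRing.Theory Num.Theory.
Import numFieldNormedType.Exports.

Local Open Scope classical_set_scope.
Local Open Scope card_scope.
Local Open Scope ring_scope.

Definition trace_system (T : Type) (C : set_system T) (Y0 : set T) :
    set_system T :=
  [set A `&` Y0 | A in C].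

Definition shatters (T : Type) (C : set_system T) (Y0 : set T) : Prop :=
  trace_system C Y0 = [set A | A `<=` Y0].

(* Set systems live on a subset Y of an ambient type T. [counting Y0] is the
   number of elements of Y0, +oo if Y0 is infinite; the supremum is -oo exactly
   when C is empty, since a nonempty C shatters the empty set. *)
Definition vc_dim (R : realType) (T : choiceType) (Y : set T)
    (C : set_system T) : \bar R :=
  ereal_sup [set (counting Y0 : \bar R) |
              Y0 in [set Y0 | Y0 `<=` Y /\ shatters C Y0]].

Definition binom_le (m d : nat) : nat :=
  if (d <= m)%N then (\sum_(0 <= i < d.+1) 'C(m, i))%N else (2 ^ m)%N.

Definition maximum_of_vc_dim (R : realType) (T : choiceType) (Y : set T)
    (C : set_system T) (d : nat) : Prop :=
  [/\ forall A, C A -> A `<=` Y,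
      vc_dim R Y C = d%:R%:E &
      forall (m : nat) (Y0 : set T), Y0 `<=` Y -> Y0 #= `I_m ->
        trace_system C Y0 #= `I_(binom_le m d)].

Definition fun_span (R : realType) (X : Type) (k : nat)
    (f : 'I_k -> X -> R) : set (X -> R) :=
  [set g | exists c : 'I_k -> R, forall x, g x = \sum_(i < k) c i * f i x].

Definition lin_indep (R : realType) (X : Type) (k : nat)
    (f : 'I_k -> X -> R) : Prop :=
  forall c : 'I_k -> R,
    (forall x, \sum_(i < k) c i * f i x = 0) -> forall i, c i = 0.

(* The first clause says that F is a finite-dimensional space of functions. *)
Definition admissible (R : realType) (X : topologicalType)
    (F : set (X -> R)) : Prop :=
  (exists k (f : 'I_k -> X -> R), F = fun_span f) /\
  forall f, F f ->
    continuous f /\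
    ((f @^-1` [set 0])° !=set0 -> forall x, f x = 0).

Definition baire_space (T : topologicalType) : Prop :=
  [set: T] !=set0 /\
  forall F : nat -> set T,
    (forall i, closed (F i) /\ (F i)° = set0) ->
    (\bigcup_i F i)° = set0.

(* Main.v *)
Require Import Defs.
From mathcomp Require Import all_boot all_order all_algebra.
From mathcomp Require Import all_classical all_reals all_analysis.
From mathcomp Require Import finmap ring lra.

Set Implicit Arguments.
Unset Strict Implicit.
Unset Printing Implicit Defensive.

Import Order.TTheory GRing.Theory Num.Theory.
Import numFieldNormedType.Exports.

Local Open Scope classical_set_scope.
Local Open Scope card_scope.
Local Open Scope ring_scope.

(** Writing f - g for f = f_0 and g in the span of f_1, ..., f_n as a functional
    c with c_0 = 1 applied to the vector (f_0(x), ..., f_n(x)), each point x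
    becomes an affine hyperplane in the n-dimensional space of parameters c, and
    a trace of the set system on a finite set of points becomes a cell (a sign
    vector) of the resulting hyperplane arrangement, where a cell is open on
    its positive sides and closed on the others.  The theorem is thus the
    classical count: m hyperplanes in general position in an n-dimensional
    affine space cut it into sum_(i <= n) binom(m, i) cells.

    Points in general position exist by a greedy choice.  Given finitely many
    points, the next one has to avoid finitely many proper subspaces of
    R^(n+1), namely the spans of at most n of the vectors chosen so far.  Each of
    them lies in a hyperplane, so the points to be avoided are among the zeros
    of a finite product of nonzero members of F.  Such a product is continuous
    with a nowhere dense zero set; its nonzero set is infinite because otherwise
    it would take finitely many values, its zero set would be open, hence empty,
    and X would be finite ([nondegenerate_support_infinite],
    [gen_pos_extend]).  The unit vector e_0, which encodes the normalisation
    c_0 = 1 (the hyperplane at infinity), is put in the family from the start, as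
    the index [None] of [option X].

    The cells are counted by deletion and restriction ([card_cells]).  Removing
    a hyperplane H merges the cells in pairs exactly when they meet along H, so
    the number of cells is the number of cells without H plus the number of
    cells of the arrangement induced on H; this is Pascal's rule for
    [binom_le].  The induction keeps the list Z of hyperplanes to which the
    parameter has been restricted, so that every restriction stays in the same
    ambient space.

    Finally, the numbers of traces alone determine the VC dimension: a set of
    size m can have 2^m traces only if m <= n, and it does have them for m = n
    ([maximum_of_card]). *)

(** * Truncated binomial sums *)

(** The sum formula also covers m < d, the extra binomials being zero; Pascal's
    rule can then be applied without a case distinction. *)
Lemma binom_le_sum m d : binom_le m d = (\sum_(0 <= i < d.+1) 'C(m, i))%N.
Proof.
rewrite /binom_le; case: leqP => // md.
have -> : (2 ^ m = \sum_(0 <= i < m.+1) 'C(m, i))%N.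
  rewrite big_mkord -[2%N]/(1 + 1)%N expnDn.
  by apply: eq_bigr => i _; rewrite !exp1n !muln1.
rewrite (big_cat_nat (leq0n m.+1) (leqW md)) /=.
rewrite [X in (_ + X)%N]big_nat_cond [X in (_ + X)%N]big1 ?addn0 // => i.
by rewrite andbT => /andP[mi _]; rewrite bin_small.
Qed.

Lemma binom_le0n d : binom_le 0 d = 1%N.
Proof.
by rewrite binom_le_sum big_nat_recl // bin0 big1 // => i _; rewrite bin0n.
Qed.

Lemma binom_len0 m : binom_le m 0 = 1%N.
Proof. by rewrite binom_le_sum big_nat1 bin0. Qed.

Lemma binom_leS m d :
  binom_le m.+1 d.+1 = (binom_le m d.+1 + binom_le m d)%N.
Proof.
rewrite !binom_le_sum big_nat_recl // [in RHS]big_nat_recl //.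
rewrite !bin0 -addnA -big_split /=.
by congr (_ + _)%N; apply: eq_bigr => i _; rewrite binS.
Qed.

Lemma binom_le_expn m d : (m <= d)%N -> binom_le m d = (2 ^ m)%N.
Proof.
elim: m d => [|m IHm] [|d] // md; rewrite ?binom_le0n //.
by rewrite binom_leS !IHm ?leqW // expnS mul2n addnn.
Qed.

Lemma binom_le_lt_expn m d : (d < m)%N -> (binom_le m d < 2 ^ m)%N.
Proof.
move=> dm; rewrite -(@binom_le_expn m m) // !binom_le_sum.
have dm' : (d.+1 <= m.+1)%N by exact: ltnW.
rewrite [X in (_ < X)%N](big_cat_nat (leq0n d.+1) dm') /=.
by rewrite [X in (_ < _ + X)%N]big_nat_recr //= binn addnA addn1 ltnS leq_addr.
Qed.

(** * Cardinals of finite sets *)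

Lemma card_eq_seq (T : choiceType) (s : seq T) :
  uniq s -> [set` s] #= `I_(size s).
Proof.
move=> s_uniq.
have -> : [set` s] = [set` [fset x in s]%fset].
  by apply/seteqP; split => x /=; rewrite inE.
by apply/card_eq_fsetP; rewrite card_fseq undup_id.
Qed.

Lemma card_eq_seqP (T : choiceType) (A : set T) m :
  A #= `I_m -> exists s : seq T, [/\ uniq s, size s = m & A = [set` s]].
Proof.
move=> Am; exists (fset_set A); split => //; first exact: card_fset_set.
by rewrite -[LHS]fset_setK //; exists m.
Qed.

Lemma card_eq_finset (T : finType) (P : {set T}) : [set` P] #= `I_#|P|.
Proof.
rewrite cardE; have -> : [set` P] = [set` enum P].
  by apply/seteqP; split => x /=; rewrite mem_enum.
exact/card_eq_seq/enum_uniq.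
Qed.

(** * Functionals and vectors in general position *)

Section Hyperplanes.
Variables (F : fieldType) (k : nat).
Implicit Types (u : 'rV[F]_k) (W : 'M[F]_k) (c : 'cV[F]_k).

(** Row vectors are the data, column vectors the functionals on them. *)
Definition ev u c : F := (u *m c) 0 0.

Lemma evD u c d : ev u (c + d) = ev u c + ev u d.
Proof. by rewrite /ev mulmxDr mxE. Qed.

Lemma evZ u a c : ev u (a *: c) = a * ev u c.
Proof. by rewrite /ev -scalemxAr mxE. Qed.

Lemma mulmx_ev u c : u *m c = (ev u c)%:M.
Proof. by rewrite [LHS]mx11_scalar. Qed.

Lemma separating_functional u W :
  ~~ (u <= W)%MS -> exists c, W *m c = 0 /\ ev u c = 1.
Proof.
rewrite submxE => /eqP uN0.
have [j uj] : exists j, (u *m cokermx W) 0 j != 0.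
  apply/existsP; apply: contra_notT uN0 => /existsPn H.
  by apply/rowP => j; rewrite !mxE; apply/eqP; move/negbNE: (H j); rewrite mxE.
set a := (u *m cokermx W) 0 j in uj.
exists (a^-1 *: col j (cokermx W)); split.
  by rewrite -scalemxAr colE mulmxA mulmx_coker mul0mx scaler0.
by rewrite evZ /ev colE mulmxA -colE [col _ _ _ _]mxE mulVf.
Qed.

Lemma ev_nonzero_notin u W c : W *m c = 0 -> ev u c != 0 -> ~~ (u <= W)%MS.
Proof.
move=> Wc; apply: contraNN => /submxP[D ->].
by rewrite /ev -mulmxA Wc mulmx0 mxE.
Qed.

Lemma proper_sub_hyperplane W :
  (\rank W < k)%N -> exists2 c : 'cV[F]_k, c != 0 & W *m c = 0.
Proof.
move=> rW; have /row_subPn[i] : ~~ ((1%:M : 'M[F]_k) <= W)%MS.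
  by apply: contraTN rW => /mxrankS; rewrite mxrank1 -leqNgt.
case/separating_functional => c [Wc c1]; exists c => //.
by apply: contra_eq_neq c1 => ->; rewrite /ev mulmx0 mxE eq_sym oner_neq0.
Qed.
End Hyperplanes.

Section GeneralPosition.
Variables (F : fieldType) (k : nat) (I : eqType) (w : I -> 'rV[F]_k).
Implicit Types (s t : seq I).

Definition span t : 'M[F]_k := (\sum_(i <- t) <<w i>>)%MS.

(** Linear general position: any at most k of the vectors (counted with their
    indices) are independent. *)
Definition gen_pos s :=
  forall t, subseq t s -> (size t <= k)%N -> \rank (span t) = size t.

Lemma span_cons i t : (span (i :: t) :=: w i + span t)%MS.
Proof. by rewrite /span big_cons; apply: adds_eqmx => //; apply: genmxE. Qed.

Lemma mem_span i t : i \in t -> (w i <= span t)%MS.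
Proof.
elim: t => // j t IHt; rewrite inE span_cons => /predU1P[->|/IHt wi].
  exact: addsmxSl.
exact: submx_trans wi (addsmxSr _ _).
Qed.

Lemma rank_span t : (\rank (span t) <= size t)%N.
Proof.
elim: t => [|i t IHt]; first by rewrite /span big_nil mxrank0.
rewrite span_cons (leq_trans (mxrank_adds_leqif _ _)) //.
exact: leq_add (rank_leq_row _) IHt.
Qed.

Lemma rank_span_cons i t :
  ~~ (w i <= span t)%MS -> \rank (span t) = size t ->
  \rank (span (i :: t)) = (size t).+1.
Proof.
move=> wi rt; apply/eqP; rewrite eqn_leq rank_span /= -rt span_cons.
by apply: rank_ltmx; rewrite ltmxE addsmxSr addsmx_sub negb_and wi.
Qed.

(** This is what makes the greedy choice work: the new vector only has to avoid
    the spans of fewer than k old ones. *)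
Lemma gen_pos_cons i s : gen_pos s ->
  (forall t, subseq t s -> (size t < k)%N -> ~~ (w i <= span t)%MS) ->
  gen_pos (i :: s).
Proof.
move=> gs wi [|j t] /=; first by move=> _ _; exact: (gs [::] (sub0seq _)).
case: eqVneq => [->|_] sub_t lt_t; last exact: gs.
by apply: rank_span_cons; [apply: wi | apply: gs => //; apply: ltnW].
Qed.

Lemma gen_pos_rank s t : gen_pos s -> uniq s -> uniq t -> {subset t <= s} ->
  (size t <= k)%N -> \rank (span t) = size t.
Proof.
move=> gs us ut ts.
have pt : perm_eq t [seq i <- s | i \in t].
  apply: uniq_perm => //; first exact: filter_uniq.
  by move=> i; rewrite mem_filter andb_idr //; exact: ts.
rewrite (perm_size pt) /span (perm_big _ pt) /=.
exact/gs/filter_subseq.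
Qed.

Lemma gen_pos_sub s s' : gen_pos s -> uniq s -> uniq s' ->
  {subset s' <= s} -> gen_pos s'.
Proof.
move=> gs us us' ss' t ts; apply: gen_pos_rank gs us (subseq_uniq ts us') _.
by move=> i /(mem_subseq ts)/ss'.
Qed.

Lemma span_kill c t : {in t, forall i, ev (w i) c = 0} -> span t *m c = 0.
Proof.
move=> tc; apply/sub_kermxP; elim: t tc => [|i t IHt] tc.
  by rewrite /span big_nil sub0mx.
rewrite span_cons addsmx_sub IHt ?andbT; last first.
  by move=> j jt; rewrite tc // inE jt orbT.
by apply/sub_kermxP; rewrite mulmx_ev tc ?mem_head // raddf0.
Qed.

Lemma kill_span c t i : span t *m c = 0 -> i \in t -> ev (w i) c = 0.
Proof.
by move=> tc /mem_span/submxP[D ->]; rewrite /ev -mulmxA tc mulmx0 mxE.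
Qed.

(** Elements of a dual basis.  They give points in intersections of few
    hyperplanes, and directions along such an intersection that leave one
    further hyperplane. *)
Lemma gen_pos_dual s t i : gen_pos s -> uniq s ->
  uniq (i :: t) -> {subset i :: t <= s} -> (size t < k)%N ->
  exists c, ev (w i) c = 1 /\ {in t, forall j, ev (w j) c = 0}.
Proof.
move=> gs us ut ts lt_t.
have [|c [tc c1]] := @separating_functional _ _ (w i) (span t).
  apply/negP => wi.
  have := gen_pos_rank gs us ut ts lt_t.
  have <- : \rank (span t) = \rank (span (i :: t)).
    by rewrite span_cons (addsmx_idPr wi).
  by move=> eq_r; move: (rank_span t); rewrite eq_r /= ltnn.
by exists c; split => // j; exact: kill_span.
Qed.

(** Any k of the vectors form a basis.  For affine hyperplanes in dimension
    n = k - 1: at most one point lies on n of them, and none on n + 1. *)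
Lemma gen_pos_eq0 s t c : gen_pos s -> uniq s ->
  uniq t -> {subset t <= s} -> size t = k ->
  {in t, forall i, ev (w i) c = 0} -> c = 0.
Proof.
move=> gs us ut ts st /span_kill tc.
have /row_fullP[B BW] : row_full (span t).
  by rewrite /row_full (gen_pos_rank gs us ut ts) st.
by rewrite -[c]mul1mx -BW -mulmxA tc mulmx0.
Qed.
End GeneralPosition.

(** * Counting the cells of an arrangement *)

Lemma cons_tuple_eq m (T : Type) a b (p q : m.-tuple T) :
  cons_tuple a p = cons_tuple b q -> a = b /\ p = q.
Proof. by move=> /(congr1 val) [-> /val_inj ->]. Qed.

(** Deleting the first sign identifies two sign vectors when both extensions of
    the shorter vector occur, which the intersection counts a second time. *)
Lemma card_tuple_cons m (A : {set m.+1.-tuple bool}) :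
  (#|A| = #|[set p | cons_tuple true p \in A]
              :|: [set p | cons_tuple false p \in A]|
          + #|[set p | cons_tuple true p \in A]
              :&: [set p | cons_tuple false p \in A]|)%N.
Proof.
rewrite cardsUI -(cardsID [set p | thead p] A).
have cons_inj b : injective (cons_tuple b : m.-tuple bool -> _).
  by move=> p q E; case: (cons_tuple_eq E).
congr (_ + _)%N.
  rewrite -[RHS](card_imset _ (cons_inj true)); apply: eq_card => p.
  case/tupleP: p => b p; rewrite !inE theadE.
  apply/andP/imsetP => [[bpA bT]|[q]].
    by exists p; rewrite ?inE; case: b bT bpA.
  by rewrite inE => qA E; have [-> ->] := cons_tuple_eq E.
rewrite -[RHS](card_imset _ (cons_inj false)); apply: eq_card => p.
case/tupleP: p => b p; rewrite !inE theadE.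
apply/andP/imsetP => [[bF bpA]|[q]].
  by exists p; rewrite ?inE; case: b bF bpA.
by rewrite inE => qA E; have [-> ->] := cons_tuple_eq E.
Qed.

(** Zeros of a stay zeros, and the finitely many nonzero values keep their sign
    under a small enough multiple of b. *)
Lemma small_perturbation (R : realFieldType) (I : eqType) (s : seq I)
    (a b : I -> R) : {in s, forall i, a i = 0 -> b i = 0} ->
  exists2 e, 0 < e & {in s, forall i, (0 < a i + e * b i) = (0 < a i)}.
Proof.
move=> ab; suff [e e0 He] : exists2 e, 0 < e & forall d, 0 < d <= e ->
    {in s, forall i, (0 < a i + d * b i) = (0 < a i)}.
  by exists e => //; apply: He; rewrite e0 lexx.
elim: s ab => [|i s IHs] ab; first by exists 1.
have [|e e0 He] := IHs; first by move=> j js; apply: ab; rewrite inE js orbT.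
suff [e' e'0 He'] : exists2 e', 0 < e' & forall d, 0 < d <= e' ->
    (0 < a i + d * b i) = (0 < a i).
  exists (Num.min e e') => [|d]; first by rewrite lt_min e0.
  rewrite le_min => /and3P[d0 de de'] j; rewrite inE => /predU1P[->|js].
    by apply: He'; rewrite d0.
  by apply: He => //; rewrite d0.
have [ai0|ai0] := eqVneq (a i) 0.
  by exists 1 => // d _; rewrite (ab _ (mem_head _ _) ai0) mulr0 addr0.
have b1 : 0 < `|b i| + 1 by rewrite ltr_wpDl.
(* Adding 1 to the denominator also treats b i = 0. *)
exists (`|a i| / (`|b i| + 1)); first by rewrite divr_gt0 ?normr_gt0.
move=> d /andP[d0]; rewrite ler_pdivlMr // => dab.
have : `|d * b i| < `|a i|.
  rewrite normrM (gtr0_norm d0); apply: lt_le_trans dab.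
  by rewrite ltr_pM2l ?ltrDl.
case: (ltgtP (a i) 0) ai0 => // ai0 _.
  rewrite (ltr0_norm ai0) ltr_norml => /andP[? ?].
  by apply/negbTE; rewrite -leNgt; lra.
by rewrite (gtr0_norm ai0) ltr_norml => /andP[? ?]; lra.
Qed.

Section Cells.
Variables (R : realFieldType) (n : nat) (I : eqType).
Variables (w : I -> 'rV[R]_n.+1) (o : I).
Implicit Types (Z S : seq I) (c : 'cV[R]_n.+1).

(** The index o plays the hyperplane at infinity: [ev (w o) c = 1] cuts out the
    affine space of parameters, and Z lists the hyperplanes to which it is
    restricted. *)
Definition in_flat Z c := ev (w o) c = 1 /\ {in Z, forall i, ev (w i) c = 0}.

Definition signs S c : (size S).-tuple bool :=
  [tuple of [seq 0 < ev (w i) c | i <- in_tuple S]].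

Definition cells Z S : {set (size S).-tuple bool} :=
  [set p | `[< exists2 c, in_flat Z c & signs S c = p >]].

Lemma in_cells Z S p :
  reflect (exists2 c, in_flat Z c & signs S c = p) (p \in cells Z S).
Proof. by rewrite inE; exact: asboolP. Qed.

Lemma signs_cons i S c :
  signs (i :: S) c = cons_tuple (0 < ev (w i) c) (signs S c).
Proof. exact/val_inj. Qed.

Lemma eq_signs S c d :
  {in S, forall i, (0 < ev (w i) c) = (0 < ev (w i) d)} <->
  signs S c = signs S d.
Proof.
split=> [cd|/(congr1 val)/= /eq_in_map //].
by apply: val_inj => /=; apply/eq_in_map.
Qed.

Lemma cells_cons_union Z i S :
  [set p | cons_tuple true p \in cells Z (i :: S)]
    :|: [set p | cons_tuple false p \in cells Z (i :: S)] = cells Z S.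
Proof.
apply/setP => p; rewrite !inE; apply/orP/asboolP => [|[c Zc <-]].
  by case=> /asboolP[c Zc]; rewrite signs_cons => E;
    have [_ <-] := cons_tuple_eq E; exists c.
by case E : (0 < ev (w i) c); [left|right]; apply/asboolP; exists c => //;
  rewrite signs_cons E.
Qed.

(** Two parameters with the same signs on S lie in a common convex cell; the
    segment between them crosses the hyperplane of i if they differ there. *)
Lemma in_flat_segment Z i S c d :
  in_flat Z c -> in_flat Z d -> 0 < ev (w i) c -> ev (w i) d <= 0 ->
  signs S c = signs S d ->
  exists2 e, in_flat (i :: Z) e & signs S e = signs S c.
Proof.
move=> [co cZ] [do_ dZ] ic id_ /eq_signs cd.
set a := ev (w i) c in ic; set b := ev (w i) d in id_.
have ab : 0 < a - b by rewrite subr_gt0 (le_lt_trans id_).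
have abN := lt0r_neq0 ab.
(* The zero of ev (w i) on the segment from c to d. *)
pose e := (a - b)^-1 *: (a *: d + (- b) *: c).
have evE j : ev (w j) e = (a - b)^-1 * (a * ev (w j) d - b * ev (w j) c).
  by rewrite /e evZ evD !evZ mulNr.
exists e.
  split=> [|j]; first by rewrite evE co do_ !mulr1 mulVf.
  rewrite inE evE => /predU1P[->|jZ]; first by rewrite mulrC -/a -/b; ring.
  by rewrite cZ // dZ // !mulr0 subr0 mulr0.
apply/eq_signs => j jS; have := cd j jS; rewrite evE pmulr_rgt0 ?invr_gt0 //.
case: (ltP 0 (ev (w j) c)) => jc /esym jd.
  by apply/idP; nra.
by apply/negbTE; move/negbT: jd; rewrite -!leNgt => jd; nra.
Qed.

(** A cell lies on both sides of the hyperplane of i exactly when it meets it.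
    One direction is convexity.  For the other, start from a point c on the
    hyperplane, which has the negative sign there, and move it to the positive
    side; the signs at the other hyperplanes through c must be kept, so the
    motion has to stay inside all of them.  General position provides such a
    direction, because at most n hyperplanes pass through c. *)
Lemma cells_cons_inter Z i S : gen_pos w (o :: i :: Z ++ S) ->
  uniq (o :: i :: Z ++ S) -> (size Z < n)%N ->
  [set p | cons_tuple true p \in cells Z (i :: S)]
    :&: [set p | cons_tuple false p \in cells Z (i :: S)] = cells (i :: Z) S.
Proof.
move=> gp un ltZ; apply/setP => p; rewrite !inE.
apply/andP/asboolP => [[/asboolP[c Zc sc] /asboolP[d Zd sd]]|[c iZc <-]].
  move: sc sd; rewrite !signs_cons.
  move=> Ec Ed; have [ic cp] := cons_tuple_eq Ec.
  have [id_ dp] := cons_tuple_eq Ed.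
  rewrite -cp; apply: (in_flat_segment Zc Zd); rewrite ?ic ?cp //.
  by rewrite leNgt id_.
have [co icZ] := iZc; have ci : ev (w i) c = 0 by apply: icZ; rewrite mem_head.
have cZ : in_flat Z c by split=> // j jZ; apply: icZ; rewrite inE jZ orbT.
split; apply/asboolP; last by exists c => //; rewrite signs_cons ci ltxx.
pose S0 := [seq j <- S | ev (w j) c == 0].
have [un_o un_i unZS] :
    [/\ o \notin i :: Z ++ S, i \notin Z ++ S & uniq (Z ++ S)].
  by move: un => /= /and3P[].
have sub0 : subseq (Z ++ S0) (Z ++ S) by rewrite subseq_cat2l filter_subseq.
have un0 : uniq (i :: Z ++ S0).
  rewrite /= (subseq_uniq sub0 unZS) andbT.
  by apply: contra un_i; exact: mem_subseq.
have mem0 : {subset i :: Z ++ S0 <= i :: Z ++ S}.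
  move=> j; rewrite !inE => /predU1P[->|/(mem_subseq sub0)->]; rewrite ?eqxx //.
  by rewrite orbT.
have c0 : {in i :: Z ++ S0, forall j, ev (w j) c = 0}.
  move=> j; rewrite inE mem_cat mem_filter => /predU1P[->//|/orP[jZ|]].
    by case: cZ => _; apply.
  by case/andP => /eqP.
(* With n + 1 of these vectors killed, c would be zero, whereas ev (w o) c = 1. *)
have size0 : (size (i :: Z ++ S0) <= n)%N.
  rewrite leqNgt; apply/negP => lt_n.
  suff c_eq0 : c = 0 by move: co; rewrite c_eq0 /ev mulmx0 mxE => /eqP;
    rewrite eq_sym oner_eq0.
  pose t := take n.+1 (i :: Z ++ S0).
  apply: (@gen_pos_eq0 _ _ _ _ _ t c gp un).
  - exact: take_uniq.
  - by move=> j /mem_take/mem0 jt; rewrite inE jt orbT.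
  - by rewrite size_takel.
  - by move=> j /mem_take/c0.
have [|||d [di dZ]] := @gen_pos_dual _ _ _ _ _ (o :: Z ++ S0) i gp un.
- rewrite -(cat1s i) -(cat1s o) uniq_catCA cons_uniq un0 andbT.
  by apply: contra un_o => /mem0.
- move=> j; rewrite !inE orbCA => /orP[->//|].
  by rewrite -in_cons => /mem0; rewrite inE => ->; rewrite orbT.
- by move: size0 => /=; rewrite ltnS.
have [|e e0 He] := @small_perturbation R I S (fun j => ev (w j) c)
    (fun j => ev (w j) d).
  move=> j jS /eqP jc; apply: dZ.
  by rewrite inE mem_cat mem_filter jc jS !orbT.
have evE j : ev (w j) (c + e *: d) = ev (w j) c + e * ev (w j) d.
  by rewrite evD evZ.
exists (c + e *: d).
  split=> [|j jZ]; rewrite evE dZ ?inE ?eqxx ?mem_cat ?jZ ?orbT // mulr0 addr0 //.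
  by case: cZ => _; apply.
rewrite signs_cons evE di ci add0r mulr1 e0.
by congr cons_tuple; apply/eq_signs => j jS; rewrite evE He.
Qed.

Lemma in_flat_exists Z S : gen_pos w (o :: Z ++ S) -> uniq (o :: Z ++ S) ->
  (size Z <= n)%N -> exists c, in_flat Z c.
Proof.
move=> gp un leZ.
apply: (gen_pos_dual gp un) => //.
  by move: un; rewrite -cat_cons cat_uniq => /and3P[].
by move=> j; rewrite -cat_cons mem_cat => ->.
Qed.

Lemma in_flat_unique Z S c d : gen_pos w (o :: Z ++ S) -> uniq (o :: Z ++ S) ->
  size Z = n -> in_flat Z c -> in_flat Z d -> c = d.
Proof.
move=> gp un eZ [co cZ] [do_ dZ]; apply/eqP; rewrite -subr_eq0; apply/eqP.
apply: (@gen_pos_eq0 _ _ _ _ _ (o :: Z) _ gp un).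
- by move: un; rewrite -cat_cons cat_uniq => /and3P[].
- by move=> j; rewrite -cat_cons mem_cat => ->.
- by rewrite /= eZ.
move=> j; rewrite -scaleN1r evD evZ mulN1r inE => /predU1P[->|jZ].
  by rewrite co do_ subrr.
by rewrite cZ // dZ // subrr.
Qed.

(** Deletion and restriction.  When size Z = n the flat is a single point, with a
    single sign vector; otherwise the first hyperplane of S is deleted, or moved
    to Z, and the two counts add up by Pascal's rule. *)
Theorem card_cells Z S : gen_pos w (o :: Z ++ S) -> uniq (o :: Z ++ S) ->
  (size Z <= n)%N -> #|cells Z S| = binom_le (size S) (n - size Z).
Proof.
elim: S Z => [|i S IHS] Z gp un leZ.
  have [c Zc] := in_flat_exists gp un leZ.
  rewrite binom_le0n; apply/eqP/cards1P; exists [tuple].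
  apply/setP => p; rewrite [p]tuple0 inE eqxx; apply/in_cells; exists c => //.
  exact: tuple0.
move: leZ; rewrite leq_eqVlt => /predU1P[eZ|ltZ].
  have [c Zc] := in_flat_exists gp un (eq_leq eZ).
  rewrite eZ subnn binom_len0; apply/eqP/cards1P; exists (signs (i :: S) c).
  apply/setP => p; rewrite inE; apply/in_cells/eqP => [[d Zd <-]|->].
    by rewrite (in_flat_unique gp un eZ Zd Zc).
  by exists c.
have perm_iZS : perm_eq (o :: Z ++ i :: S) (o :: i :: Z ++ S).
  by rewrite perm_cons perm_catC /= perm_cons perm_catC.
have un' : uniq (o :: i :: Z ++ S) by rewrite -(perm_uniq perm_iZS).
have gp' : gen_pos w (o :: i :: Z ++ S).
  by apply: gen_pos_sub gp un un' _ => j; rewrite (perm_mem perm_iZS).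
have sub_ZS : subseq (o :: Z ++ S) (o :: i :: Z ++ S).
  by rewrite /= eqxx; exact: subseq_cons.
rewrite card_tuple_cons cells_cons_union cells_cons_inter // !IHS //;
  last 2 first.
- exact: subseq_uniq un'.
- exact: ltnW.
- by rewrite -(subnSK ltZ) binom_leS.
by move=> t st; apply: gp'; exact: subseq_trans sub_ZS.
Qed.
End Cells.

(** * Generic points of the space *)

Lemma uniq_None_Some (T : eqType) (s : seq T) :
  uniq s -> uniq (None :: map Some s).
Proof.
have Some_inj : injective (@Some T) by move=> x y [].
move=> s_uniq; rewrite /= (map_inj_uniq Some_inj) s_uniq andbT.
by apply/mapP => -[].
Qed.

Section Nondegenerate.
Variables (R : realType) (X : topologicalType).
Implicit Types g h : X -> R.

Definition nondegenerate g := continuous g /\ (g @^-1` [set 0])° = set0.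

Lemma open_preimage_cofinite g (A : set R) :
  continuous g -> finite_set A -> open (g @^-1` (~` A)).
Proof.
move=> /continuousP g_cont A_fin; apply/g_cont/closed_openC.
by have /accessible_finite_set_closed := hausdorff_accessible (@Rhausdorff R);
  apply.
Qed.

Lemma nondegenerate1 : nondegenerate (fun=> 1).
Proof.
split; first by move=> x; exact: cvg_cst.
have -> : (fun=> 1 : R) @^-1` [set 0] = set0 :> set X.
  by apply/seteqP; split => x //= /eqP; rewrite oner_eq0.
exact: interior0.
Qed.

(** A nonempty open set inside the union of the two zero sets would, outside the
    closed first one, be an open part of the second. *)
Lemma nondegenerateM g h :
  nondegenerate g -> nondegenerate h -> nondegenerate (fun x => g x * h x).
Proof.
move=> [g_cont g0] [h_cont h0]; split.
  by move=> x; apply: continuousM; [exact: g_cont | exact: h_cont].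
set U := interior _.
have sub_U : U `<=` (g @^-1` [set 0]) `|` (h @^-1` [set 0]).
  move=> x /interior_subset /= /eqP; rewrite mulf_eq0.
  by move=> /orP[] /eqP ?; [left|right].
have open_U : open U by exact: open_interior.
have U_g : U `<=` g @^-1` [set 0].
  move=> x Ux; apply: contrapT => gx.
  suff : (h @^-1` [set 0])° x by rewrite h0.
  have open_V : open (U `&` g @^-1` (~` [set 0])).
    by apply: openI => //; exact: open_preimage_cofinite.
  have : U `&` g @^-1` (~` [set 0]) `<=` h @^-1` [set 0].
    by move=> y [/sub_U[]].
  by rewrite (open_subsetE _ open_V); apply.
by move: U_g; rewrite open_subsetE // g0 subset0.
Qed.

(** If g were nonzero at finitely many points only, its zero set would be the
    preimage of the complement of a finite set, hence open, hence empty: g would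
    vanish nowhere on the infinite space. *)
Lemma nondegenerate_support_infinite g : infinite_set [set: X] ->
  nondegenerate g -> infinite_set [set x | g x != 0].
Proof.
move=> X_inf [g_cont g0] fin; apply: X_inf.
apply: (sub_finite_set _ fin) => x _ /=.
apply/eqP => gx0.
have zeroE : g @^-1` [set 0] = g @^-1` (~` (g @` [set y | g y != 0])).
  apply/seteqP; split => y /= => [gy [z /= gz gzy]|H].
    by move: gz; rewrite gzy gy eqxx.
  by apply/eqP; apply: contrapT => /negP gy; apply: H; exists y.
have /interior_id : open (g @^-1` [set 0]).
  by rewrite zeroE; apply: open_preimage_cofinite g_cont _; exact: finite_image.
by rewrite g0 => /seteqP[_ /(_ x gx0)].
Qed.
End Nondegenerate.

Section GenericPoints.
Variables (R : realType) (X : topologicalType) (k : nat).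
Variable w : option X -> 'rV[R]_k.
Hypothesis w_nondeg : forall c : 'cV[R]_k, c != 0 ->
  nondegenerate (fun x => ev (w (Some x)) c).
Hypothesis X_inf : infinite_set [set: X].

(** Every proper subspace lies in the kernel of a nonzero functional, and the
    product of these functionals is nondegenerate.  Getting infinitely many
    points allows the next point to differ from the previous ones even when the
    vectors do not tell points apart (k = 1). *)
Lemma avoid_subspaces (Ws : seq 'M[R]_k) :
  all (fun W => \rank W < k)%N Ws ->
  infinite_set [set x | all (fun W => ~~ (w (Some x) <= W)%MS) Ws].
Proof.
move=> rWs; suff [g g_nd gP] : exists2 g : X -> R, nondegenerate g &
    forall x, g x != 0 -> all (fun W => ~~ (w (Some x) <= W)%MS) Ws.
  have := nondegenerate_support_infinite X_inf g_nd.
  by apply: sub_infinite_set => x /gP.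
elim: Ws rWs => [|W Ws IHWs] /=.
  by exists (fun=> 1) => //; exact: nondegenerate1.
case/andP => rW /IHWs[g g_nd gP].
have [c c0 Wc] := proper_sub_hyperplane rW.
exists (fun x => ev (w (Some x)) c * g x).
  by apply: nondegenerateM => //; exact: w_nondeg.
move=> x; rewrite mulf_eq0 negb_or => /andP[xc /gP ->].
by rewrite (ev_nonzero_notin Wc).
Qed.

Lemma gen_pos_extend (s : seq (option X)) : gen_pos w s ->
  exists2 x, Some x \notin s & gen_pos w (Some x :: s).
Proof.
move=> gs.
pose ts := [seq t <- [seq mask m s | m : (size s).-tuple bool]
               | (size t < k)%N].
have r_ts : all (fun W => \rank W < k)%N (map (span w) ts).
  rewrite all_map; apply/allP => t; rewrite mem_filter => /andP[lt_t _] /=.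
  exact: leq_ltn_trans (rank_span w t) lt_t.
have s_fin : finite_set [set x | Some x \in s].
  apply: (@finite_preimage _ _ [set` s] Some) => [x y _ _ []|] //.
have [x [/= x_ts x_s]] :=
  infinite_setN0 (infinite_setD (avoid_subspaces r_ts) s_fin).
exists x; first exact/negP.
apply: gen_pos_cons => // t /subseqP[m size_m tE] lt_t.
move/allP: x_ts; apply; apply/map_f; rewrite mem_filter lt_t tE.
apply/mapP; exists (Tuple (introT eqP size_m)) => //.
by rewrite mem_enum.
Qed.

(** The points are added in front of [None], which therefore comes last during
    the induction. *)
Lemma gen_pos_points N : w None != 0 -> exists xs : seq X,
  [/\ uniq xs, size xs = N & gen_pos w (None :: map Some xs)].
Proof.
move=> w0; suff [xs [xs_uniq xs_size xs_gp]] : exists xs : seq X,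
    [/\ uniq xs, size xs = N & gen_pos w (rcons (map Some xs) None)].
  have perm_xs : perm_eq (rcons (map Some xs) None) (None :: map Some xs).
    by rewrite perm_rcons.
  exists xs; split => //.
  have un := uniq_None_Some xs_uniq.
  have un' : uniq (rcons (map Some xs) None) by rewrite (perm_uniq perm_xs).
  apply: (gen_pos_sub xs_gp un' un).
  by move=> i; rewrite (perm_mem perm_xs).
elim: N => [|N [xs [xs_uniq xs_size xs_gp]]].
  exists [::]; split => // -[|[x|] [|i t]] //= _ _.
    by rewrite /span big_nil mxrank0.
  by rewrite span_cons /span big_nil addsmx0 rank_rV w0.
have [x xs_x x_gp] := gen_pos_extend xs_gp.
exists (x :: xs); split => //=; last by rewrite xs_size.
rewrite xs_uniq andbT; apply: contra xs_x => x_xs.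
by rewrite mem_rcons inE map_f.
Qed.
End GenericPoints.

(** * Traces as sign vectors *)

Section Decode.
Variables (T : choiceType) (ys : seq T).
Hypothesis ys_uniq : uniq ys.

Definition decode (p : seq bool) : set T := [set` mask p ys].

Lemma decode_inj m : size ys = m -> injective (fun p : m.-tuple bool => decode p).
Proof.
move=> ys_size p q /seteqP[pq qp].
have pqE : mask p ys =i mask q ys.
  by move=> x; apply/idP/idP => [/pq|/qp].
case: ys ys_size ys_uniq pqE => [|x0 s] size_s uniq_s pqE.
  by apply: val_inj; rewrite /= (size0nil (_ : size p = 0%N)) ?size_tuple //;
   rewrite (size0nil (_ : size q = 0%N)) ?size_tuple.
apply: val_inj; apply: (@eq_from_nth _ false); rewrite ?size_tuple // => i lt_i.
have := pqE (nth x0 (x0 :: s) i).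
by rewrite !in_mask // mem_nth ?size_s // index_uniq // size_s.
Qed.

Lemma decode_map (b : T -> bool) : decode (map b ys) = [set x | x \in ys /\ b x].
Proof.
rewrite /decode -filter_mask; apply/seteqP; split => x /=.
  by rewrite mem_filter => /andP[].
by rewrite mem_filter => -[-> ->].
Qed.

Lemma card_decode m (P : {set m.-tuple bool}) : size ys = m ->
  [set decode p | p in [set` P]] #= `I_#|P|.
Proof.
move=> ys_size; apply: card_eq_trans (card_eq_finset P).
by apply: inj_card_eq => p q _ _; exact: decode_inj.
Qed.

Lemma card_subsets : [set A | A `<=` [set` ys]] #= `I_(2 ^ size ys).
Proof.
have <- : #|[set: (size ys).-tuple bool]%SET| = (2 ^ size ys)%N.
  by rewrite cardsT card_tuple card_bool.
have -> : [set A | A `<=` [set` ys]] =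
    [set decode p | p in [set` [set: (size ys).-tuple bool]%SET]].
  apply/seteqP; split => [A Ays|_ [p _ <-] x /mem_mask //].
  exists [tuple of map (fun x => x \in A) (in_tuple ys)]; first by rewrite /= inE.
  rewrite decode_map; apply/seteqP; split => x /=; first by case=> _ /set_mem.
  by move=> Ax; split; [exact: Ays | exact/mem_set].
exact: card_decode.
Qed.
End Decode.

Lemma eq_set_card (T : choiceType) (A B : set T) m :
  A `<=` B -> A #= `I_m -> B #= `I_m -> A = B.
Proof.
move=> AB Am Bm.
have fA : finite_set A by exists m.
have fB : finite_set B by exists m.
apply: fset_set_inj => //; apply/fsetP.
apply/fsubset_cardP; last by rewrite -fset_set_sub.
by rewrite (card_fset_set Am) (card_fset_set Bm).
Qed.

Lemma counting_card (R : realType) (T : choiceType) (A : set T) m :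
  A #= `I_m -> counting A = m%:R%:E :> \bar R.
Proof.
move=> Am; rewrite /counting asboolT; last by exists m.
by rewrite (card_fset_set Am).
Qed.

(** * From numbers of traces to the VC dimension *)

(** A shattered set of size m has 2^m = [binom_le m d] traces, so m <= d; and any
    set of size d has all its subsets as traces. *)
Lemma maximum_of_card (R : realType) (T : choiceType) (Y : set T)
    (C : set_system T) N d :
  Y #= `I_N -> (d <= N)%N -> (forall A, C A -> A `<=` Y) ->
  (forall m Y0, Y0 `<=` Y -> Y0 #= `I_m ->
     trace_system C Y0 #= `I_(binom_le m d)) ->
  maximum_of_vc_dim R Y C d.
Proof.
move=> YN dN CY C_card; split => //; rewrite /vc_dim.
have [xs [xs_uniq xs_size YE]] := card_eq_seqP YN.
apply/eqP; rewrite eq_le; apply/andP; split.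
  apply: ge_ereal_sup => _ [Y0 [Y0Y Y0_sh] <-].
  have [m Y0m] : finite_set Y0 by apply: sub_finite_set Y0Y _; exists N.
  rewrite (counting_card R Y0m) lee_fin ler_nat leqNgt; apply/negP => dm.
  have := C_card _ _ Y0Y Y0m; rewrite Y0_sh.
  have [ys [ys_uniq ys_size ->]] := card_eq_seqP Y0m.
  rewrite (card_eql (card_subsets ys_uniq)) ys_size => /card_eq_II eq2.
  by have := binom_le_lt_expn dm; rewrite -eq2 ltnn.
apply: ereal_sup_ubound.
have size_ys : size (take d xs) = d by rewrite size_takel // xs_size.
have uniq_ys : uniq (take d xs) by exact: take_uniq.
have ys_card := card_eq_seq uniq_ys; rewrite size_ys in ys_card.
have ysY : [set` take d xs] `<=` Y by rewrite YE => x /= /mem_take.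
exists [set` take d xs]; last exact: counting_card.
split => //; apply: (@eq_set_card _ _ _ (2 ^ d)).
- by move=> _ [A _ <-]; exact: subIsetr.
- by rewrite -(@binom_le_expn d d) //; exact: C_card.
- by have := card_subsets uniq_ys; rewrite size_ys.
Qed.

(** * The arrangement of a family of functions *)

Section FunctionSpace.
Variables (R : realType) (X : topologicalType) (n : nat).
Variable f : 'I_n.+1 -> X -> R.

(** The index [None] stands for the point at infinity: the functional of f_0 - g
    takes the value 1 there. *)
Definition evaluation (i : option X) : 'rV[R]_n.+1 :=
  if i is Some x then \row_j f j x else delta_mx 0 0.

Lemma ev_Some x c : ev (evaluation (Some x)) c = \sum_j c j 0 * f j x.
Proof. by rewrite /ev mxE; apply: eq_bigr => j _; rewrite mxE mulrC. Qed.

Lemma ev_None c : ev (evaluation None) c = c 0 0.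
Proof.
by rewrite /ev /evaluation -rowE mxE.
Qed.

Lemma evaluation_nondegenerate : lin_indep f -> admissible (fun_span f) ->
  forall c : 'cV[R]_n.+1, c != 0 ->
    nondegenerate (fun x => ev (evaluation (Some x)) c).
Proof.
move=> f_indep [_ f_adm] c c0.
have [|g_cont g0] := f_adm (fun x => ev (evaluation (Some x)) c).
  by exists (fun j => c j 0) => x; rewrite ev_Some.
split=> //; apply/eqP; apply: contraNT c0 => /set0P /g0 c_zero.
apply/eqP/colP => j; rewrite mxE; apply: (f_indep (fun j => c j 0)) => x.
by rewrite -ev_Some c_zero.
Qed.

(** Parameters with c_0 = 1 are the functions f_0 - g. *)
Lemma span_coordinates g : fun_span (fun i : 'I_n => f (lift ord0 i)) g <->
  exists2 c, ev (evaluation None) c = 1 &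
    forall x, ev (evaluation (Some x)) c = f ord0 x - g x.
Proof.
split=> [[a gE]|[c]].
  exists (\col_j if unlift ord0 j is Some i then - a i else 1).
    by rewrite ev_None mxE unlift_none.
  move=> x; rewrite ev_Some big_ord_recl mxE unlift_none mul1r gE; congr (_ + _).
  by rewrite -sumrN; apply: eq_bigr => i _; rewrite mxE liftK mulNr.
rewrite ev_None => c0 gE; exists (fun i => - c (lift ord0 i) 0) => x.
have := gE x; rewrite ev_Some big_ord_recl c0 mul1r => /addrI gxE.
rewrite -[LHS]opprK -gxE -sumrN.
by apply: eq_bigr => i _; rewrite mulNr.
Qed.

Definition sign_system : set_system X :=
  [set [set x | f ord0 x - g x > 0]
     | g in fun_span (fun i : 'I_n => f (lift ord0 i))].

Lemma trace_sign_system (ys : seq X) :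
  trace_system sign_system [set` ys] =
  [set decode ys p | p in [set` cells evaluation None [::] (map Some ys)]].
Proof.
have signsE c g : (forall x, ev (evaluation (Some x)) c = f ord0 x - g x) ->
    decode ys (signs evaluation (map Some ys) c) =
    [set x | f ord0 x - g x > 0] `&` [set` ys].
  move=> cg; rewrite /= -map_comp decode_map; apply/seteqP.
  by split=> x /=; rewrite cg => -[].
apply/seteqP; split => [_ [_ [g /span_coordinates[c c0 cg] <-] <-]|].
  exists (signs evaluation (map Some ys) c); last exact: (signsE _ _ cg).
  by apply/in_cells; exists c.
move=> _ [_ /in_cells[c [c0 _] <-] <-].
pose g x := f ord0 x - ev (evaluation (Some x)) c.
have cg x : ev (evaluation (Some x)) c = f ord0 x - g x by rewrite /g subKr.
exists [set x | f ord0 x - g x > 0]; last by rewrite (signsE _ _ cg).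
by exists g => //; apply/span_coordinates; exists c.
Qed.
End FunctionSpace.

Lemma trace_system_sub (T : Type) (C : set_system T) (Y Y0 : set T) :
  Y0 `<=` Y -> trace_system (trace_system C Y) Y0 = trace_system C Y0.
Proof.
move=> Y0Y; apply/seteqP; split => [_ [_ [A CA <-] <-]|_ [A CA <-]].
  by exists A => //; rewrite -setIA (setIidr Y0Y).
by exists (A `&` Y); [exists A | rewrite -setIA (setIidr Y0Y)].
Qed.

Theorem theorem3p1 (R : realType) (X : topologicalType)
    (X_infinite : infinite_set [set: X])
    (X_baire : forall N : nat, baire_space {ptws 'I_N -> X})
    (n : nat) (f : 'I_n.+1 -> X -> R)
    (f_indep : lin_indep f)
    (f_adm : admissible (fun_span f))
    (N : nat) (hN : (n < N)%N) :
  let C : set_system X :=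
    [set [set x | f ord0 x - g x > 0]
       | g in fun_span (fun i : 'I_n => f (lift ord0 i))] in
  exists X0 : set X,
    X0 #= `I_N /\ maximum_of_vc_dim R X0 (trace_system C X0) n.
Proof.
move=> C.
have w_nondeg := evaluation_nondegenerate f_indep f_adm.
have w_None : evaluation f None != 0.
  by apply/eqP => /rowP/(_ 0)/eqP; rewrite !mxE oner_eq0.
have [xs [xs_uniq xs_size xs_gp]] :=
  gen_pos_points w_nondeg X_infinite N w_None.
have X0_card : [set` xs] #= `I_N by rewrite -xs_size; exact: card_eq_seq.
exists [set` xs]; split => //.
apply: (maximum_of_card R X0_card (ltnW hN)) => [_ [A _ <-]|m Y0 Y0X Y0m].
  exact: subIsetr.
have [ys [ys_uniq ys_size Y0E]] := card_eq_seqP Y0m.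
rewrite trace_system_sub // Y0E -/(sign_system f) trace_sign_system.
have ys_gp : gen_pos (evaluation f) (None :: map Some ys).
  apply: (gen_pos_sub xs_gp (uniq_None_Some xs_uniq) (uniq_None_Some ys_uniq)).
  move=> i; rewrite !inE => /orP[->//|/mapP[y y_ys ->]]; apply/orP; right.
  by apply: map_f; apply: Y0X; rewrite Y0E.
have <- : #|cells (evaluation f) None [::] (map Some ys)| = binom_le m n.
  rewrite (@card_cells _ _ _ _ _ [::] _ ys_gp (uniq_None_Some ys_uniq)) //.
  by rewrite subn0 size_map ys_size.
by apply: card_decode => //; rewrite size_map.
Qed.
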